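(* For $i=1,2$ consider forward complete systems $\Sigma_i:\ \frac{d}{dt}x_i(t)=f_i(x_i(t),w_i(t))$ with $x_i(0)\in\mathbb{R}^{n_i}$, $w_i\in\mathcal{W}^{m_i}$, where $f_i:\mathbb{R}^{n_i}\times\mathbb{R}^{m_i}\to\mathbb{R}^{n_i}$ is locally Lipschitz in its first argument, locally uniformly in its second argument. Suppose that there are $\beta_i,\gamma_i\in\mathcal{K}_\infty$ such that, for $i=1,2$, $$\|x_i\|_{\mathcal{L}_2[0,t]}^2\le\max\left\{\beta_i(|x_i(0)|),\ \gamma_i\left(\|w_i\|_{\mathcal{L}_2[0,t]}^2\right)\right\}$$ for all $x_i(0)\in\mathbb{R}^{n_i}$, $w_i\in\mathcal{W}^{m_i}$, $t\in\mathbb{R}_{\ge0}$. Let $m_1=n_2$ and consider the cascade interconnection defined by $w_1=x_2$. Then there exist $\beta,\gamma\in\mathcal{K}_\infty$ such that the cascade satisfies $$\|x\|_{\mathcal{L}_2[0,t]}^2\le\max\left\{\beta(|x(0)|),\ \gamma\left(\|w_2\|_{\mathcal{L}_2[0,t]}^2\right)\right\}$$ for all $x(0)=[x_1^T(0)\ x_2^T(0)]^T\in\mathbb{R}^{n_1+n_2}$, $w_2\in\mathcal{W}^{m_2}$, and $t\in\mathbb{R}_{\ge0}$, where $x(t)=[x_1^T(t)\ x_2^T(t)]^T$.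
   Context: $\mathcal{W}^m$ is the set of measurable, locally essentially bounded functions $w:\mathbb{R}_{\ge0}\to\mathbb{R}^m$. Forward complete means that for every initial condition and every input in the input class the solution exists for all $t\ge 0$. $\mathcal{K}_\infty$ is the class of continuous, strictly increasing, unbounded functions $\alpha:\mathbb{R}_{\ge0}\to\mathbb{R}_{\ge0}$ with $\alpha(0)=0$. $|\cdot|$ is the Euclidean norm, and $\|y\|_{\mathcal{L}_2[0,t]}^2:=\int_0^t|y(\tau)|^2d\tau$. *)

(* Defs.v *)
From HB Require Import structures.
From mathcomp Require Import all_boot all_order all_algebra.
From mathcomp Require Import all_classical all_reals all_analysis.

Set Implicit Arguments.
Unset Strict Implicit.
Unset Printing Implicit Defensive.

Import Order.TTheory GRing.Theory Num.Theory.
Import numFieldNormedType.Exports.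

Local Open Scope classical_set_scope.
Local Open Scope ring_scope.

(* Functions on the half-line [0, +oo[ are encoded as functions on the whole of
   R; their values at negative arguments are never used.

   All measure theory is done with the completed Lebesgue measure, so that
   "measurable" means Lebesgue measurable (the library's [lebesgue_measure]
   lives on the Borel sigma-algebra). *)
Notation leb R := (@completed_lebesgue_measure R).

(* The library's norm on matrices is the sup norm, hence this definition. *)
Definition enorm (R : realType) n (v : 'cV[R]_n) : R :=
  Num.sqrt (\sum_(i < n) (v i 0) ^+ 2).

Definition sqL2 (R : realType) n (y : R -> 'cV[R]_n) (t : R) : R :=
  \int[leb R]_(s in `[0, t]) (enorm (y s)) ^+ 2.

Definition class_Kinf (R : realType) (alpha : R -> R) : Prop :=
  [/\ {within `[0, +oo[, continuous alpha},
      forall s t, 0 <= s -> s < t -> alpha s < alpha t,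
      forall M, exists2 s, 0 <= s & M < alpha s
    & alpha 0 = 0].

Definition input_class (R : realType) m (w : R -> 'cV[R]_m) : Prop :=
  (forall i, measurable_fun
     (`[0, +oo[ : set (caratheodory_type (wlength (@idfun R))^*%mu))
     (fun t => w t i 0)) /\
  (forall T : R, exists M : R,
     {ae leb R, forall t, 0 <= t <= T -> enorm (w t) <= M}).

Definition locally_lipschitz_fst (R : realType) n m
    (f : 'cV[R]_n -> 'cV[R]_m -> 'cV[R]_n) : Prop :=
  forall x0 w0, exists r : R, exists L : R, 0 < r /\
    forall x y w, enorm (x - x0) < r -> enorm (y - x0) < r ->
      enorm (w - w0) < r -> enorm (f x w - f y w) <= L * enorm (x - y).

(* The intervals may be degenerate; these contribute nothing to either sum. *)
Definition absolutely_continuous_on (R : realType) n (a b : R)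
    (x : R -> 'cV[R]_n) : Prop :=
  forall e : R, 0 < e -> exists2 d : R, 0 < d &
    forall k (l r : 'I_k -> R),
      (forall i, a <= l i /\ l i <= r i /\ r i <= b) ->
      trivIset setT (fun i => `]l i, r i[%classic) ->
      \sum_(i < k) (r i - l i) < d ->
      \sum_(i < k) enorm (x (r i) - x (l i)) < e.

(* Solutions in the sense of Caratheodory on [0, +oo[; inputs are merely
   measurable, so the differential equation can only hold almost everywhere. *)
Definition is_solution (R : realType) n m
    (f : 'cV[R]_n -> 'cV[R]_m -> 'cV[R]_n)
    (x0 : 'cV[R]_n) (w : R -> 'cV[R]_m) (x : R -> 'cV[R]_n) : Prop :=
  [/\ x 0 = x0,
      forall T : R, absolutely_continuous_on 0 T x
    & {ae leb R, forall t, 0 < t -> is_derive (t : R) 1 x (f (x t) (w t))}].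

Definition forward_complete (R : realType) n m
    (f : 'cV[R]_n -> 'cV[R]_m -> 'cV[R]_n) : Prop :=
  forall x0 w, input_class w -> exists x, is_solution f x0 w x.

Definition L2_estimate (R : realType) n m
    (f : 'cV[R]_n -> 'cV[R]_m -> 'cV[R]_n) (beta gamma : R -> R) : Prop :=
  forall x0 w x, input_class w -> is_solution f x0 w x ->
  forall t : R, 0 <= t ->
    sqL2 x t <= Num.max (beta (enorm x0)) (gamma (sqL2 w t)).

Definition cascade (R : realType) n1 n2 m2
    (f1 : 'cV[R]_n1 -> 'cV[R]_n2 -> 'cV[R]_n1)
    (f2 : 'cV[R]_n2 -> 'cV[R]_m2 -> 'cV[R]_n2)
    (x : 'cV[R]_(n1 + n2)) (w2 : 'cV[R]_m2) : 'cV[R]_(n1 + n2) :=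
  col_mx (f1 (usubmx x) (dsubmx x)) (f2 (dsubmx x) w2).

(* Main.v *)
(* The second component x2 of a trajectory of the cascade is absolutely
   continuous, hence measurable and locally bounded: an admissible input for the
   first system. So both estimates apply along the cascade, and substituting the
   second into the first gives
     |x1|^2 <= max {beta1, gamma1 o beta2, gamma1 o gamma2},
     |x2|^2 <= max {beta2, gamma2},
   which add up to |x|^2 = |x1|^2 + |x2|^2 with
     beta = 2 (beta1 + gamma1 o beta2 + beta2),
     gamma = 2 (gamma1 o gamma2 + gamma2). *)
Require Import Defs.
From mathcomp Require Import all_boot all_order all_algebra.
From mathcomp Require Import all_classical all_reals all_analysis.
From mathcomp Require Import measurable_realfun.

Set Implicit Arguments.
Unset Strict Implicit.
Unset Printing Implicit Defensive.

Import Order.TTheory GRing.Theory Num.Theory.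
Import numFieldNormedType.Exports.

Local Open Scope classical_set_scope.
Local Open Scope ring_scope.

(** * The Euclidean norm of stacked vectors *)

Section EuclideanNorm.
Variable R : realType.

Lemma enorm_ge0 n (v : 'cV[R]_n) : 0 <= enorm v.
Proof. exact: sqrtr_ge0. Qed.

Lemma sqr_enorm n (v : 'cV[R]_n) : enorm v ^+ 2 = \sum_(i < n) v i 0 ^+ 2.
Proof. by rewrite sqr_sqrtr// sumr_ge0// => i _; rewrite sqr_ge0. Qed.

Lemma sqr_enorm_col_mx n1 n2 (u : 'cV[R]_n1) (v : 'cV[R]_n2) :
  enorm (col_mx u v) ^+ 2 = enorm u ^+ 2 + enorm v ^+ 2.
Proof.
rewrite !sqr_enorm big_split_ord/=.
by congr (_ + _); apply: eq_bigr => i _; rewrite (col_mxEu, col_mxEd).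
Qed.

Lemma le_enorm n1 n2 (u : 'cV[R]_n1) (v : 'cV[R]_n2) :
  enorm u ^+ 2 <= enorm v ^+ 2 -> enorm u <= enorm v.
Proof. by rewrite ler_sqr ?nnegrE ?enorm_ge0. Qed.

Lemma normr_coord_le_enorm n (v : 'cV[R]_n) i : `|v i 0| <= enorm v.
Proof.
rewrite -ler_sqr ?nnegrE ?enorm_ge0// sqr_enorm real_normK ?num_real//.
by rewrite (bigD1 i)//= lerDl sumr_ge0// => j _; rewrite sqr_ge0.
Qed.

Lemma enorm_usubmx n1 n2 (v : 'cV[R]_(n1 + n2)) : enorm (usubmx v) <= enorm v.
Proof.
by apply: le_enorm; rewrite -[v in leRHS]vsubmxK sqr_enorm_col_mx lerDl sqr_ge0.
Qed.

Lemma enorm_dsubmx n1 n2 (v : 'cV[R]_(n1 + n2)) : enorm (dsubmx v) <= enorm v.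
Proof.
by apply: le_enorm; rewrite -[v in leRHS]vsubmxK sqr_enorm_col_mx lerDr sqr_ge0.
Qed.

Lemma enorm_col_mx_le n1 n2 (u : 'cV[R]_n1) (v : 'cV[R]_n2) :
  enorm (col_mx u v) <= enorm u + enorm v.
Proof.
rewrite -ler_sqr ?nnegrE ?addr_ge0 ?enorm_ge0// sqr_enorm_col_mx sqrrD.
by rewrite lerD2r lerDl mulrn_wge0// mulr_ge0 ?enorm_ge0.
Qed.

End EuclideanNorm.

(** * Sums and compositions of comparison functions *)

Section ClassKinf.
Variable R : realType.
Implicit Types alpha : R -> R.

Lemma Kinf_le alpha : class_Kinf alpha ->
  forall s t, 0 <= s -> s <= t -> alpha s <= alpha t.
Proof.
move=> [_ incr _ _] s t s0; rewrite le_eqVlt => /predU1P[->//|st].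
exact/ltW/incr.
Qed.

Lemma Kinf_ge0 alpha : class_Kinf alpha -> forall s, 0 <= s -> 0 <= alpha s.
Proof.
by move=> Ka s s0; have [_ _ _ <-] := Ka; exact: Kinf_le.
Qed.

Lemma Kinf_add alpha1 alpha2 : class_Kinf alpha1 -> class_Kinf alpha2 ->
  class_Kinf (fun s => alpha1 s + alpha2 s).
Proof.
move=> K1 K2; have [c1 i1 u1 z1] := K1; have [c2 i2 u2 z2] := K2; split.
- by move=> s; apply: cvgD; [exact: c1|exact: c2].
- by move=> s t s0 st; apply: ltrD; [exact: i1|exact: i2].
- move=> M; have [s s0 Ms] := u1 M; exists s => //.
  by rewrite (lt_le_trans Ms)// lerDl (Kinf_ge0 K2).
- by rewrite z1 z2 addr0.
Qed.

Lemma Kinf_comp alpha1 alpha2 : class_Kinf alpha1 -> class_Kinf alpha2 ->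
  class_Kinf (alpha1 \o alpha2).
Proof.
move=> K1 K2; have [c1 i1 u1 z1] := K1; have [c2 i2 u2 z2] := K2.
have mem0 s : (s \in `[0, +oo[) = (0 <= s :> R) by rewrite in_itv/= andbT.
split.
- apply/subspace_continuousP => s /=; rewrite mem0 => s0.
  have As : `[0, +oo[%classic s by rewrite /= mem0.
  have Aas : `[0, +oo[%classic (alpha2 s) by rewrite /= mem0 (Kinf_ge0 K2).
  have c2s := (subspace_continuousP _ _).1 c2 s As.
  have c1s := (subspace_continuousP _ _).1 c1 (alpha2 s) Aas.
  (* [alpha1] is controlled near [alpha2 s] only within the half-line; this suffices because
     [alpha2] maps the half-line into itself. *)
  move=> B /c1s /= /c2s; rewrite !nbhs_simpl /within/=.
  apply: filterS => t + t0; apply => //.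
  by move: t0; rewrite !mem0; exact: Kinf_ge0.
- by move=> s t s0 st; apply: i1; [exact: Kinf_ge0|exact: i2].
- move=> M; have [s s0 Ms] := u1 M; have [t t0 st] := u2 s; exists t => //.
  by rewrite (lt_le_trans Ms)//=; apply: Kinf_le => //; exact: ltW.
- by rewrite /= z2.
Qed.

End ClassKinf.

(** * From Borel to Lebesgue measurability *)

Section CompletedMeasure.
Variable R : realType.

Local Notation lebesgueR := (caratheodory_type (wlength (@idfun R))^*%mu).

Lemma borel_measurable_completed (A : set R) :
  measurable A -> measurable (A : set lebesgueR).
Proof. exact: sub_caratheodory. Qed.

(** Only the sigma-algebra on the domain grows; the sets pulled back are still Borel. *)
Lemma borel_measurable_fun_completed (D : set R) (f : R -> R) :
  measurable D -> measurable_fun D f -> measurable_fun (D : set lebesgueR) f.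
Proof.
by move=> mD mf _ B mB; apply: borel_measurable_completed; exact: mf.
Qed.

Lemma continuous_integrable_completed (f : R -> R) (a b : R) :
  {within `[a, b], continuous f} -> (leb R).-integrable `[a, b] (EFin \o f).
Proof.
move=> cf; have mab : measurable (`[a, b] : set lebesgueR).
  exact: borel_measurable_completed.
apply: measurable_bounded_integrable => //.
(* Both measures restrict the same outer measure, so finiteness computed on the Borel side transfers
   by conversion. *)
- have : (lebesgue_measure `[a, b] < +oo)%E.
    by rewrite lebesgue_measure_itv; case: ifPn => // _; exact: ltry.
  exact.
- apply: borel_measurable_fun_completed => //.
  exact: subspace_continuous_measurable_fun.
- have /compact_bounded[M [_ mrt]] :=
    continuous_compact cf (@segment_compact _ a b).
  by exists M; split; rewrite ?num_real // => ? ? ? ?; exact: mrt.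
Qed.

End CompletedMeasure.

(** * Absolutely continuous trajectories as admissible inputs *)

Section AbsolutelyContinuous.
Variable R : realType.

Lemma absolutely_continuous_coord n (x : R -> 'cV[R]_n) i :
  (forall T, absolutely_continuous_on 0 T x) ->
  {within `[0, +oo[, continuous (fun t => x t i 0)}.
Proof.
move=> ac; apply/subspace_continuousP => t; rewrite /= in_itv/= andbT => t0.
apply/cvgrPdist_lt => e e0.
(* The horizon [t + 1] leaves room to the right of [t]; the radius [Num.min d 1] below keeps [s]
   inside it. *)
have [d d0 acd] := ac (t + 1) e e0.
have close l r : 0 <= l -> l <= r -> r <= t + 1 -> r - l < d ->
    `|x r i 0 - x l i 0| < e.
  move=> l0 lr rt rld.
  (* Absolute continuity is applied to a single interval, for which disjointness is trivial. *)
  have := acd 1%N (fun=> l) (fun=> r); rewrite !big_ord1 => acd1.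
  have := normr_coord_le_enorm (x r - x l) i; rewrite !mxE => /le_lt_trans.
  by apply; apply: acd1 => // j k _ _ _; rewrite !ord1.
near=> s.
have s0 : 0 <= s.
  have : s \in `[0, +oo[ by near: s; exact: withinT.
  by rewrite in_itv/= andbT.
have : `|t - s| < Num.min d 1.
  near: s; apply: cvg_within; apply/nbhs_ballP; exists (Num.min d 1) => //=.
  by rewrite lt_min d0 ltr01.
rewrite lt_min => /andP[std st1].
have [st|/ltW ts] := leP s t.
- apply: close => //; first by rewrite lerDl.
  by rewrite (le_lt_trans (ler_norm _)).
- rewrite distrC; apply: close => //.
    by rewrite -lerBlDl (le_trans (ler_norm _))// distrC ltW.
  by rewrite (le_lt_trans (ler_norm _))// distrC.
Unshelve. all: by end_near. Qed.

(** The square is a polynomial in the coordinates, so no square root is involved. This gives both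
    the local bound on inputs and the integrability behind [sqL2]. *)
Lemma within_continuous_sqr_enorm n (x : R -> 'cV[R]_n) :
  (forall T, absolutely_continuous_on 0 T x) ->
  forall T, {within `[0, T], continuous (fun t => enorm (x t) ^+ 2)}.
Proof.
move=> ac T.
have -> : (fun t => enorm (x t) ^+ 2) = fun t => \sum_(i < n) x t i 0 ^+ 2.
  by apply/funext => t; exact: sqr_enorm.
have sub : `[0, T] `<=` (`[0, +oo[ : set R).
  by move=> t /=; rewrite !in_itv/= => /andP[->].
apply: (continuous_subspaceW sub); apply: continuous_big => [|i _ t].
  exact: add_continuous.
by apply: cvgM; exact: absolutely_continuous_coord.
Qed.

Lemma absolutely_continuous_input n (x : R -> 'cV[R]_n) :
  (forall T, absolutely_continuous_on 0 T x) -> input_class x.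
Proof.
move=> ac; split=> [i|T].
  apply: borel_measurable_fun_completed => //.
  apply: subspace_continuous_measurable_fun => //.
  exact: absolutely_continuous_coord.
(* For negative [T] the time window is empty and any bound will do; otherwise the squared norm
   attains a maximum on it. *)
have [T0|T0] := ltP T 0.
  exists 0; apply: aeW => t /andP[t0 tT].
  by have := le_lt_trans (le_trans t0 tT) T0; rewrite ltxx.
have [c _ cmax] := EVT_max T0 (within_continuous_sqr_enorm ac (T := T)).
exists (enorm (x c)); apply: aeW => t tT.
by apply: le_enorm; apply: cmax; rewrite in_itv.
Qed.

(** Meant for the two block projections, which are linear and do not increase the norm. *)
Lemma absolutely_continuous_contract n m (g : 'cV[R]_n -> 'cV[R]_m) a b x :
  (forall u v, enorm (g u - g v) <= enorm (u - v)) ->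
  absolutely_continuous_on a b x -> absolutely_continuous_on a b (g \o x).
Proof.
move=> gle ac e e0; have [d d0 acd] := ac e e0; exists d => // k l r lr tr lrd.
by apply: le_lt_trans (acd k l r lr tr lrd); apply: ler_sum => i _; exact: gle.
Qed.

Lemma absolutely_continuous_col_mx n1 n2 a b
    (x1 : R -> 'cV[R]_n1) (x2 : R -> 'cV[R]_n2) :
  absolutely_continuous_on a b x1 -> absolutely_continuous_on a b x2 ->
  absolutely_continuous_on a b (fun t => col_mx (x1 t) (x2 t)).
Proof.
move=> ac1 ac2 e e0; have e20 : 0 < e / 2 by rewrite divr_gt0.
have [d1 d10 acd1] := ac1 _ e20; have [d2 d20 acd2] := ac2 _ e20.
exists (Num.min d1 d2); first by rewrite lt_min d10.
move=> k l r lr tr; rewrite lt_min => /andP[lrd1 lrd2].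
rewrite (splitr e); apply: le_lt_trans (ltrD (acd1 k l r lr tr lrd1)
  (acd2 k l r lr tr lrd2)).
rewrite -big_split/=; apply: ler_sum => i _.
by rewrite opp_col_mx add_col_mx enorm_col_mx_le.
Qed.

End AbsolutelyContinuous.

(** * Trajectories of the cascade, block by block *)

Section Solutions.
Variable R : realType.

Lemma is_derive_cVP n (x : R -> 'cV[R]_n) (t : R) v :
  is_derive t 1 x v <-> forall i, is_derive t 1 (fun s => x s i 0) (v i 0).
Proof.
split=> [[dx <-] i|dx].
  apply: DeriveDef; first exact: (derivable_mxP _ _ _).1.
  by rewrite derive_mx// mxE.
have dbl : derivable x t 1.
  by apply/derivable_mxP => i j; rewrite ord1; have [] := dx i.
apply: DeriveDef => //; rewrite derive_mx//; apply/matrixP => i j.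
by rewrite mxE ord1; have [_] := dx i.
Qed.

Lemma is_derive_col_mxP n1 n2 (x : R -> 'cV[R]_(n1 + n2)) (t : R) v1 v2 :
  is_derive t 1 x (col_mx v1 v2) <->
  is_derive t 1 (usubmx \o x) v1 /\ is_derive t 1 (dsubmx \o x) v2.
Proof.
have uE i : (fun s => (usubmx \o x) s i 0) = fun s => x s (lshift n2 i) 0.
  by apply/funext => s; rewrite /= mxE.
have dE i : (fun s => (dsubmx \o x) s i 0) = fun s => x s (rshift n1 i) 0.
  by apply/funext => s; rewrite /= mxE.
split=> [/is_derive_cVP dx|[/is_derive_cVP dx1 /is_derive_cVP dx2]].
  split; apply/is_derive_cVP => i; rewrite (uE, dE).
    by have := dx (lshift n2 i); rewrite col_mxEu.
  by have := dx (rshift n1 i); rewrite col_mxEd.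
apply/is_derive_cVP => i; rewrite -[i]splitK; case: (fintype.split i) => j /=.
  by have := dx1 j; rewrite uE col_mxEu.
by have := dx2 j; rewrite dE col_mxEd.
Qed.

(** Left to right, this lets the two given estimates be applied along a cascade trajectory; right to
    left, it assembles a cascade trajectory from two separate ones, the two exceptional null sets
    being united. *)
Lemma is_solution_cascade n1 n2 m2
    (f1 : 'cV[R]_n1 -> 'cV[R]_n2 -> 'cV[R]_n1)
    (f2 : 'cV[R]_n2 -> 'cV[R]_m2 -> 'cV[R]_n2) x0 w x :
  is_solution (cascade f1 f2) x0 w x <->
  is_solution f1 (usubmx x0) (dsubmx \o x) (usubmx \o x) /\
  is_solution f2 (dsubmx x0) w (dsubmx \o x).
Proof.
have aeF : Filter (nbhs (almost_everywhere (leb R))).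
  exact: ae_filter_ringOfSetsType.
split=> [[x0E ac dx]|[[x0E1 ac1 dx1] [x0E2 ac2 dx2]]].
  split; split=> [|T|]; rewrite /= ?x0E//.
  - apply: absolutely_continuous_contract (ac T) => u v.
    by rewrite -linearB enorm_usubmx.
  - by apply: (filterS _ dx) => t dxt t0; have /is_derive_col_mxP[] := dxt t0.
  - apply: absolutely_continuous_contract (ac T) => u v.
    by rewrite -linearB enorm_dsubmx.
  - by apply: (filterS _ dx) => t dxt t0; have /is_derive_col_mxP[] := dxt t0.
split=> [|T|].
- by rewrite -(vsubmxK (x 0)) -(vsubmxK x0); congr col_mx.
- have := absolutely_continuous_col_mx (ac1 T) (ac2 T).
  congr absolutely_continuous_on; apply/funext => t; exact: vsubmxK.
- apply: filterS2 dx1 dx2 => t dx1 dx2 t0.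
  by apply/is_derive_col_mxP; split; [exact: dx1|exact: dx2].
Qed.

End Solutions.

(** * Forward completeness and the estimate for the cascade *)

Lemma sqL2_ge0 (R : realType) n (y : R -> 'cV[R]_n) t : 0 <= sqL2 y t.
Proof. by apply: Rintegral_ge0 => s _; rewrite sqr_ge0. Qed.

(** Pythagoras under the integral. Additivity asks for integrability of both terms, which comes from
    continuity on the compact window. *)
Lemma sqL2_split (R : realType) n1 n2 (x : R -> 'cV[R]_(n1 + n2)) t :
  (forall T, absolutely_continuous_on 0 T (usubmx \o x)) ->
  (forall T, absolutely_continuous_on 0 T (dsubmx \o x)) ->
  sqL2 x t = sqL2 (usubmx \o x) t + sqL2 (dsubmx \o x) t.
Proof.
move=> ac1 ac2; rewrite /sqL2 -RintegralD//.
- by apply: eq_Rintegral => s _; rewrite -sqr_enorm_col_mx/= vsubmxK.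
- exact: borel_measurable_completed.
- apply: continuous_integrable_completed; exact: within_continuous_sqr_enorm.
- apply: continuous_integrable_completed; exact: within_continuous_sqr_enorm.
Qed.

(** The cascade is triangular: the second system is solved first, and its trajectory is then fed to
    the first one as input. *)
Lemma forward_complete_cascade (R : realType) (n1 n2 m2 : nat)
    (f1 : 'cV[R]_n1 -> 'cV[R]_n2 -> 'cV[R]_n1)
    (f2 : 'cV[R]_n2 -> 'cV[R]_m2 -> 'cV[R]_n2) :
  forward_complete f1 -> forward_complete f2 ->
  forward_complete (cascade f1 f2).
Proof.
move=> fc1 fc2 x0 w wW.
have [x2 sol2] := fc2 (dsubmx x0) w wW; have [_ ac2 _] := sol2.
have [x1 sol1] := fc1 (usubmx x0) x2 (absolutely_continuous_input ac2).
exists (fun t => col_mx (x1 t) (x2 t)); apply/is_solution_cascade.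
have -> : usubmx \o (fun t => col_mx (x1 t) (x2 t)) = x1.
  by apply/funext => t /=; rewrite col_mxKu.
have -> // : dsubmx \o (fun t => col_mx (x1 t) (x2 t)) = x2.
by apply/funext => t /=; rewrite col_mxKd.
Qed.

Theorem proposition2 (R : realType) (n1 n2 m2 : nat)
    (f1 : 'cV[R]_n1 -> 'cV[R]_n2 -> 'cV[R]_n1)
    (f2 : 'cV[R]_n2 -> 'cV[R]_m2 -> 'cV[R]_n2)
    (f1_lip : locally_lipschitz_fst f1) (f2_lip : locally_lipschitz_fst f2)
    (f1_fc : forward_complete f1) (f2_fc : forward_complete f2)
    (beta1 gamma1 beta2 gamma2 : R -> R)
    (Kbeta1 : class_Kinf beta1) (Kgamma1 : class_Kinf gamma1)
    (Kbeta2 : class_Kinf beta2) (Kgamma2 : class_Kinf gamma2)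
    (est1 : L2_estimate f1 beta1 gamma1) (est2 : L2_estimate f2 beta2 gamma2) :
  forward_complete (cascade f1 f2) /\
  exists beta gamma : R -> R,
    [/\ class_Kinf beta, class_Kinf gamma
      & L2_estimate (cascade f1 f2) beta gamma].
Proof.
split; first exact: forward_complete_cascade.
pose b s := beta1 s + (gamma1 \o beta2) s + beta2 s.
pose g s := (gamma1 \o gamma2) s + gamma2 s.
have Kgb := Kinf_comp Kgamma1 Kbeta2; have Kgg := Kinf_comp Kgamma1 Kgamma2.
have Kb : class_Kinf b by exact: Kinf_add (Kinf_add Kbeta1 Kgb) Kbeta2.
have Kg : class_Kinf g by exact: Kinf_add.
(* Each block will be bounded by the maximum of [b] and [g]; the doubling absorbs the sum of the two
   blocks. *)
exists (fun s => b s + b s), (fun s => g s + g s).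
split; [exact: Kinf_add|exact: Kinf_add|].
move=> x0 w x wW /is_solution_cascade[sol1 sol2] t t0.
have [_ ac1 _] := sol1; have [_ ac2 _] := sol2.
have e2 := est2 _ _ _ wW sol2 _ t0.
have e1 := est1 _ _ _ (absolutely_continuous_input ac2) sol1 _ t0.
rewrite sqL2_split//.
set r := enorm x0; set s := sqL2 w t.
have r0 : 0 <= r := enorm_ge0 _.
have s0 : 0 <= s := sqL2_ge0 _ _.
set X1 := sqL2 (usubmx \o x) t in e1 *; set X2 := sqL2 (dsubmx \o x) t in e1 e2 *.
have X20 : 0 <= X2 := sqL2_ge0 _ _.
(* The estimates see only the blocks of the initial state; monotonicity replaces their norms by the
   full norm [r]. *)
have bu : beta1 (enorm (usubmx x0)) <= beta1 r.
  by apply: Kinf_le; rewrite ?enorm_ge0 ?enorm_usubmx.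
have bd : beta2 (enorm (dsubmx x0)) <= beta2 r.
  by apply: Kinf_le; rewrite ?enorm_ge0 ?enorm_dsubmx.
have p1 := Kinf_ge0 Kbeta1 r0; have p2 := Kinf_ge0 Kbeta2 r0.
have p3 := Kinf_ge0 Kgb r0; have p4 := Kinf_ge0 Kgg s0.
have p5 := Kinf_ge0 Kgamma2 s0.
have X2le : X2 <= Num.max (beta2 r) (gamma2 s).
  by rewrite (le_trans e2)// ge_max !le_max bd lexx orbT.
(* Being monotone, [gamma1] passes through the maximum, so no small-gain or triangle-type splitting
   is required. *)
have gX2 : gamma1 X2 <= Num.max ((gamma1 \o beta2) r) ((gamma1 \o gamma2) s).
  move: X2le; rewrite !le_max => /orP[] h; apply/orP; [left|right];
  exact: (Kinf_le Kgamma1).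
(* Every term reached is one summand of [b r] or [g s], and the remaining summands are
   nonnegative. *)
have X2m : X2 <= Num.max (b r) (g s).
  by move: X2le; rewrite !le_max => /orP[] h; apply/orP; [left|right];
  rewrite (le_trans h)// lerDr ?addr_ge0.
have X1m : X1 <= Num.max (b r) (g s).
  move: e1; rewrite !le_max => /orP[h|h].
    by rewrite (le_trans h)// (le_trans bu)// /b -addrA lerDl addr_ge0.
  move: gX2; rewrite !le_max => /orP[] h'; apply/orP; [left|right];
  rewrite (le_trans h)// (le_trans h')//.
    by rewrite /b addrAC lerDr addr_ge0.
  by rewrite lerDl.
rewrite (le_trans (lerD X1m X2m))//.
by case: (leP (b r) (g s)) => _; rewrite le_max lexx ?orbT.
Qed.
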